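(* Let $\{\widetilde{\mathbf{x}}(t)\}_{t\ge 0}$ be the sequence in $\mathbb{R}^{N^2}$ generated by the $\mathcal{CIRFE}$ recursion $$\widetilde{\mathbf{x}}(t+1)=\widetilde{\mathbf{x}}(t)-\beta_{t}\mathbf{L}_{\mathcal{P}}(t)\widetilde{\mathbf{x}}(t)+\alpha_{t}\mathcal{P}\mathbf{G}_{H}\mathbf{R}^{-1}\left(\mathbf{y}(t)-\mathbf{G}_{H}^{\top}\mathcal{P}\widetilde{\mathbf{x}}(t)\right),$$ with all objects and initialization as defined in the context. Suppose assumptions A1, A2, A3, A4, A5 and A6 listed in the context hold. Then, as $t\to\infty$, $$\mathbb{E}_{\boldsymbol{\theta}^\ast}\left[\left\|\widetilde{\mathbf{x}}(t)-\mathcal{P}\left(\mathbf{1}_{N}\otimes\boldsymbol{\theta}^{\ast}\right)\right\|^{2}\right]=O\left(\frac{1}{t}\right).$$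
   Context: Sensing model. There are $N$ agents and a fixed unknown parameter $\boldsymbol{\theta}^{\ast}\in\mathbb{R}^{N}$. At each time $t=0,1,2,\dots$ agent $n$ observes $\mathbf{y}_{n}(t)=\mathbf{H}_{n}\boldsymbol{\theta}^{\ast}+\gamma_{n}(t)\in\mathbb{R}^{M_n}$, where $\mathbf{H}_{n}\in\mathbb{R}^{M_{n}\times N}$ is deterministic and $\{\gamma_n(t)\}_t$ is a zero-mean, temporally i.i.d. noise sequence with nonsingular covariance $\mathbf{R}_n$. The stacked noise vectors $\gamma(t)=[\gamma_1(t)^\top,\dots,\gamma_N(t)^\top]^\top$ are i.i.d. over $t$ with covariance $\mathbf{R}=\mathrm{diag}[\mathbf{R}_1,\dots,\mathbf{R}_N]$ (block diagonal). $\mathbb{E}_{\boldsymbol{\theta}^\ast}$ denotes expectation when the true parameter is $\boldsymbol{\theta}^\ast$. Communication. $\{\mathbf{L}(t)\}_{t\ge0}$ is an i.i.d. sequence of random graph Laplacians ($\mathbf{L}=\mathbf{D}-\mathbf{A}$, degree matrix minus adjacency matrix) of simple undirected graphs on the vertex set $\{1,\dots,N\}$, independent of the noise, with mean $\overline{\mathbf{L}}$. $\lambda_2(\cdot)$ is the second smallest eigenvalue. Interest sets. $\widetilde{\mathcal{I}}_n\subseteq\{1,\dots,N\}$ is the set of indices of nonzero columns of $\mathbf{H}_n$. Each agent $n$ has an interest set $\mathcal{I}_n\subseteq\{1,\dots,N\}$; $\widetilde{\mathcal{I}}_n$ and $\mathcal{I}_n$ are nonempty. $\mathcal{P}_{\mathcal{I}_n}\in\mathbb{R}^{N\times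 N}$ is the diagonal matrix with $i$-th diagonal entry $1$ if $i\in\mathcal{I}_n$ and $0$ otherwise, and $\mathcal{P}=\mathrm{diag}[\mathcal{P}_{\mathcal{I}_1},\dots,\mathcal{P}_{\mathcal{I}_N}]\in\mathbb{R}^{N^2\times N^2}$ (block diagonal). Algorithm. $\widetilde{\mathbf{x}}(t)=[\widetilde{\mathbf{x}}_1(t)^\top,\dots,\widetilde{\mathbf{x}}_N(t)^\top]^\top$ with $\widetilde{\mathbf{x}}_n(t)\in\mathbb{R}^N$: the components of $\widetilde{\mathbf{x}}_n(t)$ in $\mathcal{I}_n$ are agent $n$'s estimates of the corresponding components of $\boldsymbol{\theta}^\ast$ and the other components are zero. The initial value is deterministic with $\widetilde{\mathbf{x}}(0)=\mathcal{P}\widetilde{\mathbf{x}}(0)$. $\mathbf{y}(t)=[\mathbf{y}_1(t)^\top,\dots,\mathbf{y}_N(t)^\top]^\top$; $\mathbf{G}_H=\mathrm{diag}[\mathbf{H}_1^\top,\dots,\mathbf{H}_N^\top]$ (block diagonal). $\mathbf{L}_{\mathcal{P}}(t)\in\mathbb{R}^{N^2\times N^2}$ is the block matrix whose $(n,l)$-th $N\times N$ block is $-\mathcal{P}_{\mathcal{I}_n}\sum_{r\ne n}\mathbf{L}_{nr}(t)\mathcal{P}_{\mathcal{I}_r}$ if $n=l$, and $\mathbf{L}_{nl}(t)\mathcal{P}_{\mathcal{I}_l}\mathcal{P}_{\mathcal{I}_n}$ if $n\neq l$, where $\mathbf{L}_{nl}(t)$ is the scalar $(n,l)$ entry of $\mathbf{L}(t)$;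 $\overline{\mathbf{L}_{\mathcal{P}}}=\mathbb{E}[\mathbf{L}_{\mathcal{P}}(t)]$. The weights are $\beta_t=\beta_0/(t+1)^{\delta_1}$ and $\alpha_t=a/(t+1)$ (so $\alpha_0=a$), with $a,\beta_0>0$ and $0<\delta_1<\frac12-\frac1{2+\epsilon_1}$, $\epsilon_1$ being the constant in A1. $\mathbf{1}_N$ is the all-ones vector and $\otimes$ the Kronecker product. Assumptions. A1: there is $\epsilon_1>0$ such that $\mathbb{E}_{\boldsymbol{\theta}^\ast}[\|\gamma_n(t)\|^{2+\epsilon_1}]<\infty$ for all $n$. A2: $\mathbf{G}=\sum_{n=1}^N\mathbf{H}_n^\top\mathbf{R}_n^{-1}\mathbf{H}_n$ has full rank. A3: $\widetilde{\mathcal{I}}_n\subseteq\mathcal{I}_n$ for every $n$. A4: $\lambda_2(\overline{\mathbf{L}})>0$. A5: there is $c_1>0$ such that $\mathbf{y}^\top\left(\frac{\beta_0}{\alpha_0}\overline{\mathbf{L}_{\mathcal{P}}}+\mathcal{P}\mathbf{G}_H\mathbf{R}^{-1}\mathbf{G}_H^\top\mathcal{P}\right)\mathbf{y}\ge c_1\|\mathbf{y}\|^2$ for all $\mathbf{y}\in\mathcal{S}_P=\{\mathcal{P}\mathbf{w}:\mathbf{w}\in\mathbb{R}^{N^2}\}$. A6: $a\min\left\{\lambda_{\min}\left(\sum_{n=1}^N\mathcal{P}_{\mathcal{I}_n}\mathbf{H}_n^\top\mathbf{R}_n^{-1}\mathbf{H}_n\mathcal{P}_{\mathcal{I}_n}\right),c_1,\beta_0^{-1}\right\}\ge1$,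 with $c_1$ the constant of A5 and $\lambda_{\min}$ the smallest eigenvalue. *)

(* Defs.v *)
From HB Require Import structures.
From mathcomp Require Import all_boot all_order all_algebra finmap.
From mathcomp Require Import all_classical all_reals all_analysis.
Set Implicit Arguments.
Unset Strict Implicit.
Unset Printing Implicit Defensive.
Import Order.TTheory GRing.Theory Num.Theory.
Import numFieldNormedType.Exports.
Local Open Scope classical_set_scope.
Local Open Scope ring_scope.

(* Euclidean norm; the library norm `|x| on matrices is the sup norm. *)
Definition norm2 (R : realType) (m : nat) (x : 'cV[R]_m) : R :=
  Num.sqrt (\sum_(i < m) x i 0 ^+ 2).

(* The sorted list of the eigenvalues of A, with multiplicity, when char_poly A
   splits over R (in particular when A is symmetric); empty otherwise. *)
Definition eigvals (R : realType) (n : nat) (A : 'M[R]_n) : seq R :=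
  xget [::] [set s : seq R |
    sorted <=%R s /\ char_poly A = \prod_(x <- s) ('X - x%:P)].

Definition lambda_min (R : realType) (n : nat) (A : 'M[R]_n) : R :=
  nth 0 (eigvals A) 0.

(* Equal to 0 for matrices of size less than 2: 0 < lambda_2 A forces n >= 2. *)
Definition lambda_2 (R : realType) (n : nat) (A : 'M[R]_n) : R :=
  nth 0 (eigvals A) 1.

(* Coordinate projections generate the Borel sigma-algebra of 'M_(m, n). *)
Definition mx_borel (R : realType) (m n : nat) : set (set 'M[R]_(m, n)) :=
  <<s [set B | exists (i : 'I_m) (j : 'I_n) (A : set R),
         measurable A /\ B = [set x : 'M[R]_(m, n) | A (x i j)]] >>.
Arguments mx_borel : clear implicits.

Definition sigma_of (R : realType) (T : Type) (m n : nat)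
    (X : T -> 'M[R]_(m, n)) : set (set T) :=
  preimage_set_system setT X (mx_borel R m n).

Definition random_mx (d : measure_display) (T : measurableType d)
    (R : realType) (m n : nat) (X : T -> 'M[R]_(m, n)) : Prop :=
  sigma_of X `<=` measurable.

Definition mutually_independent (d : measure_display) (T : measurableType d)
    (R : realType) (P : probability T R) (I : choiceType)
    (F : I -> set (set T)) : Prop :=
  forall (J : {fset I}) (E : I -> set T), (forall i, i \in J -> F i (E i)) ->
    P (\bigcap_(i in [set` J]) E i) = (\prod_(i <- J) P (E i))%E.

Definition iid (d : measure_display) (T : measurableType d) (R : realType)
    (P : probability T R) (m n : nat) (X : nat -> T -> 'M[R]_(m, n)) : Prop :=
  [/\ forall t, random_mx (X t),
      mutually_independent P (fun t => sigma_of (X t)) &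
      forall t B, mx_borel R m n B -> P (X t @^-1` B) = P (X 0%N @^-1` B)].

Definition independent_processes (d : measure_display) (T : measurableType d)
    (R : realType) (P : probability T R) (m n m' n' : nat)
    (X : nat -> T -> 'M[R]_(m, n)) (Y : nat -> T -> 'M[R]_(m', n')) : Prop :=
  forall A B : set T,
    <<s \bigcup_t sigma_of (X t) >> A -> <<s \bigcup_t sigma_of (Y t) >> B ->
    P (A `&` B) = (P A * P B)%E.

Definition mean_mx (d : measure_display) (T : measurableType d) (R : realType)
    (P : probability T R) (m n : nat) (X : T -> 'M[R]_(m, n)) : 'M[R]_(m, n) :=
  \matrix_(i, j) fine ('E_P[fun w => X w i j])%E.

Definition laplacian (R : realType) (N : nat) (e : rel 'I_N) : 'M[R]_N :=
  diag_mx (\row_i (#|[set j | e i j]%SET|)%:R) - \matrix_(i, j) (e i j)%:R.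

Definition is_graph_laplacian (R : realType) (N : nat) (A : 'M[R]_N) : Prop :=
  exists e : rel 'I_N, [/\ symmetric e, irreflexive e & A = laplacian R e].

Definition proj_mx_of (R : realType) (N : nat) (S : {set 'I_N}) : 'M[R]_N :=
  diag_mx (\row_i (i \in S)%:R).

(* \sum_(n < N) N is the library's dimension N^2 of a stack of N blocks of
   size N. *)
Definition Pmx (R : realType) (N : nat) (I : 'I_N -> {set 'I_N}) :
    'M[R]_(\sum_(n < N) N) :=
  \mxdiag_(n < N) proj_mx_of R (I n).

Definition GH (R : realType) (N : nat) (M : 'I_N -> nat)
    (H : forall n, 'M[R]_(M n, N)) :
    'M[R]_(\sum_(n < N) N, \sum_(n < N) M n) :=
  \mxblock_(n < N, l < N) (if n == l then (H l)^T else 0).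

Definition LP (R : realType) (N : nat) (I : 'I_N -> {set 'I_N})
    (L : 'M[R]_N) : 'M[R]_(\sum_(n < N) N) :=
  \mxblock_(n < N, l < N)
    (if n == l
     then - (proj_mx_of R (I n) *m
               \sum_(r < N | r != n) L n r *: proj_mx_of R (I r))
     else L n l *: (proj_mx_of R (I l) *m proj_mx_of R (I n))).

Definition alpha (R : realType) (a : R) (t : nat) : R := a / t.+1%:R.

Definition beta (R : realType) (beta0 delta1 : R) (t : nat) : R :=
  beta0 / t.+1%:R `^ delta1.

(* Main.v *)
Require Import Defs.
From HB Require Import structures.
From mathcomp Require Import all_boot all_order all_algebra finmap.
From mathcomp Require Import all_classical all_reals all_analysis.
From mathcomp Require Import measurable_realfun ring lra.
Set Implicit Arguments.
Unset Strict Implicit.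
Unset Printing Implicit Defensive.
Import Order.TTheory GRing.Theory Num.Theory.
Import numFieldNormedType.Exports.
Local Open Scope classical_set_scope.
Local Open Scope ring_scope.

(** The error [e t = x t - P (1 (x) theta)] stays in the range of [P] and obeys
    [e (t+1) = u t + alpha t B gamma t] with
    [u t = (I - beta t LP t - alpha t K) e t], because [LP t] annihilates
    [P (1 (x) theta)].  For every graph, [LP] is the Laplacian of the graph
    obtained, coordinate by coordinate, by keeping the edges between interested
    agents; hence [0 <= y^T LP y] and [|LP y|^2 <= 2 N y^T LP y].  As
    [beta t -> 0] and [beta t] dominates [alpha t], for large [t] this yields
    pointwise
      [|u|^2 <= (1 + O(alpha^2)) |e|^2
                 - 2 alpha e^T ((beta0 / alpha 0) LP t + K) e].
    In expectation [LP t], being independent of [e t], may be replaced by its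
    mean, so A5 bounds the last term by [- 2 alpha c1 E |e|^2]; the cross term
    with [gamma t] vanishes since [gamma t] is centered and independent of
    [u t].  Thus [m t = E |e t|^2] satisfies
      [m (t+1) <= (1 - 2 / (t+1) + C / (t+1)^2) m t + D / (t+1)^2]
    because [a c1 >= 1], and this recursion forces [m t = O(1/t)]. *)

(** * Integrable and square-integrable random variables *)

Section square_integrable.
Context (d : measure_display) (T : measurableType d) (R : realType)
  (P : probability T R).
Implicit Types f g : T -> R.

Definition L1 f := P.-integrable setT (EFin \o f).

(** Measurability of [f] is a separate clause because integrability of [f ^+ 2] does not imply
    it. *)
Definition L2 f := measurable_fun setT f /\ L1 (fun w => f w ^+ 2).

Lemma L1_measurable f : L1 f -> measurable_fun setT f.
Proof. by move=> /measurable_int /measurable_EFinP. Qed.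

Lemma L1_le f g : measurable_fun setT f -> (forall w, `|f w| <= `|g w|) ->
  L1 g -> L1 f.
Proof.
move=> mf fg; apply: le_integrable => //; first exact/measurable_EFinP.
by move=> w _; rewrite /= lee_fin.
Qed.

Lemma L1D f g : L1 f -> L1 g -> L1 (fun w => f w + g w).
Proof. by move=> lf lg; exact: (integrableD measurableT lf lg). Qed.

Lemma L1Z c f : L1 f -> L1 (fun w => c * f w).
Proof. by move=> lf; exact: (integrableZl measurableT c lf). Qed.

Lemma L1B f g : L1 f -> L1 g -> L1 (fun w => f w - g w).
Proof. by move=> lf lg; exact: (integrableB measurableT lf lg). Qed.

Lemma L1_sum (I : finType) (f : I -> T -> R) :
  (forall i, L1 (f i)) -> L1 (fun w => \sum_i f i w).
Proof.
move=> lf; rewrite /L1 (_ : EFin \o _ = fun w => (\sum_i (f i w)%:E)%E).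
  by apply: integrable_sum => // i _; exact: lf.
by apply/funext => w /=; rewrite sumEFin.
Qed.

Lemma L1_cst c : L1 (fun=> c).
Proof. exact: finite_measure_integrable_cst. Qed.

Lemma Rintegral_sum_fin (I : finType) (f : I -> T -> R) :
  (forall i, L1 (f i)) ->
  (\int[P]_w (\sum_i f i w))%R = \sum_i (\int[P]_w f i w)%R.
Proof.
move=> lf; rewrite /Rintegral; under eq_integral do rewrite -sumEFin.
rewrite integral_sum// -sum_fine// => i _.
by rewrite integrable_fin_num//; exact: lf.
Qed.

Lemma L2M f g : L2 f -> L2 g -> L1 (fun w => f w * g w).
Proof.
move=> [mf lf] [mg lg]; apply: (@L1_le _ (fun w => f w ^+ 2 + g w ^+ 2)).
- exact: measurable_funM.
- move=> w; rewrite normrM [leRHS]ger0_norm ?addr_ge0 ?sqr_ge0//.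
  rewrite -[f w ^+ 2]real_normK ?num_real// -[g w ^+ 2]real_normK ?num_real//.
  have := sqr_ge0 (`|f w| - `|g w|).
  by have := normr_ge0 (f w); have := normr_ge0 (g w); nra.
- exact: L1D.
Qed.

Lemma L2D f g : L2 f -> L2 g -> L2 (fun w => f w + g w).
Proof.
move=> lf lg; split; first by apply: measurable_funD; [case: lf|case: lg].
have -> : (fun w => (f w + g w) ^+ 2) =
    (fun w => (f w ^+ 2 + 2 * (f w * g w)) + g w ^+ 2).
  by apply/funext => w; ring.
by apply: L1D; [apply: L1D; [case: lf|exact/L1Z/L2M]|case: lg].
Qed.

Lemma L2_boundedM f g (C : R) :
  measurable_fun setT f -> (forall w, `|f w| <= C) -> L2 g -> L2 (fun w => f w * g w).
Proof.
move=> mf fC [mg lg]; have mfg := measurable_funM mf mg; split=> //.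
apply: (@L1_le _ (fun w => C ^+ 2 * g w ^+ 2)).
- exact: measurable_funX.
- move=> w; rewrite exprMn.
  rewrite ger0_norm; last exact: mulr_ge0 (sqr_ge0 _) (sqr_ge0 _).
  rewrite ger0_norm; last exact: mulr_ge0 (sqr_ge0 _) (sqr_ge0 _).
  rewrite ler_wpM2r ?sqr_ge0// -[f w ^+ 2]real_normK ?num_real//.
  by rewrite lerXn2r ?nnegrE// (le_trans _ (fC w)) ?normr_ge0.
- exact: (L1Z (C ^+ 2) lg).
Qed.

Lemma L2Z c f : L2 f -> L2 (fun w => c * f w).
Proof. exact: (@L2_boundedM (fun=> c) f `|c| (measurable_cst c)). Qed.

Lemma L2_cst c : L2 (fun=> c).
Proof. by split => //; exact: L1_cst. Qed.

Lemma L2_sum (I : finType) (f : I -> T -> R) :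
  (forall i, L2 (f i)) -> L2 (fun w => \sum_i f i w).
Proof.
move=> lf; rewrite (_ : (fun w => _) = \sum_i f i); last first.
  by apply/funext => w; rewrite fct_sumE.
apply: big_ind => [|g h lg lh|i _]; [exact: L2_cst|exact: L2D|exact: lf].
Qed.

Lemma L2_L1 f : L2 f -> L1 f.
Proof.
move=> lf; have := L2M lf (L2_cst 1).
by under [X in L1 X]eq_fun do rewrite mulr1.
Qed.

End square_integrable.

(** * Independence: extension from a pi-system, and products of expectations *)

Section independence.
Context (d : measure_display) (T : measurableType d) (R : realType)
  (P : probability T R).

(** Both [P (A & C)] and [P A * P C] are finite measures in [A]. They agree on a pi-system
    containing the whole space, hence on the sigma-algebra it generates. *)
Lemma indep_generated (G : set (set T)) (C : set T) :
  G `<=` measurable -> measurable C -> setI_closed G -> G setT ->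
  (forall A, G A -> P (A `&` C) = (P A * P C)%E) ->
  forall A, <<s G >> A -> P (A `&` C) = (P A * P C)%E.
Proof.
move=> Gm mC GI GT GC A sGA.
have PCfin : P C \is a fin_num by exact: fin_num_measure.
have r0 : 0 <= fine (P C) by rewrite fine_ge0.
pose m1 := mrestr P mC; pose m2 := mscale (NngNum r0) P.
have m2E B : m2 B = (P B * P C)%E.
  by rewrite muleC -[in RHS](fineK PCfin).
suff: m1 A = m2 A by rewrite m2E.
apply: (@g_sigma_algebra_measure_unique _ _ _ G Gm (fun=> setT)) => //.
- by rewrite bigcup_const//; exists 0%N.
- by move=> B GB; transitivity (m2 B); [rewrite m2E; exact: GC|].
- by move=> _; rewrite -ge0_fin_numE// fin_num_measure.
Qed.

(** Independence makes the law of the pair [(X, Y)] the product of the two laws, and Fubini then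
    factors the integral of [x * y]. *)
Lemma indep_integralM (X Y : T -> R) :
  L1 P X -> L1 P Y ->
  (forall A B, measurable A -> measurable B ->
     P (X @^-1` A `&` Y @^-1` B) = (P (X @^-1` A) * P (Y @^-1` B))%E) ->
  L1 P (fun w => X w * Y w) /\
  (\int[P]_w (X w * Y w))%R = (\int[P]_w X w)%R * (\int[P]_w Y w)%R.
Proof.
move=> lX lY XY.
have mX := L1_measurable lX; have mY := L1_measurable lY.
have mZ : measurable_fun setT (fun w => (X w, Y w)) by exact: measurable_fun_pair.
pose X' : {mfun T >-> R} := mfun_Sub (mem_set mX).
pose Y' : {mfun T >-> R} := mfun_Sub (mem_set mY).
pose Z' : {mfun T >-> (R * R)%type} := mfun_Sub (mem_set mZ).
pose mu := distribution P X'; pose nu := distribution P Y'.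
pose f : R * R -> \bar R := fun z => (z.1 * z.2)%:E.
have mf : measurable_fun setT f.
  apply/measurable_EFinP; apply: measurable_funM.
    exact: measurable_fst.
  exact: measurable_snd.
(* A product measure is determined by its values on rectangles, where the claim is the independence
   hypothesis. *)
have munu A : measurable A -> (mu \x nu)%E A = distribution P Z' A.
  by apply: product_measure_unique => B C mB mC; exact: XY.
have imu : mu.-integrable setT (fun x : R => x%:E).
  by apply: integrable_pushforward => //; exact/measurable_EFinP.
have inu : nu.-integrable setT (fun x : R => x%:E).
  by apply: integrable_pushforward => //; exact/measurable_EFinP.
(* By Tonelli it suffices that the iterated integral of [|x| * |y|], a product of two finite
   numbers, is finite. *)
have if2 : (mu \x nu)%E.-integrable setT f.
  apply: (snd (@integrable12ltyP _ _ _ _ R mu nu f mf)).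
  rewrite (eq_integral (fun x : R => `|x%:E| * \int[nu]_y `|y%:E|)%E); last first.
    move=> x _; rewrite -ge0_integralZl//=; last exact: measurableT_comp.
    by apply: eq_integral => y _; rewrite /f/= normrM EFinM.
  have nufin : (\int[nu]_y `|y%:E| < +oo)%E by case/integrableP : inu.
  rewrite ge0_integralZr//=; [|exact: measurableT_comp|exact: integral_ge0].
  rewrite lte_mul_pinfty//; first exact: integral_ge0.
    by rewrite ge0_fin_numE; [case/integrableP : imu|exact: integral_ge0].
have ifZ : P.-integrable setT (f \o Z').
  apply/integrableP; split; first exact: (measurableT_comp mf mZ).
  have mf' : measurable_fun setT (abse \o f) by exact: measurableT_comp.
  rewrite -(ge0_integral_distribution (P := P) Z' mf'); last first.
    by move=> y; exact: abse_ge0.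
  rewrite (eq_measure_integral (mu \x nu)%E); last first.
    by move=> A mA _; apply/esym; exact: munu.
  by case/integrableP : if2.
split; first exact: ifZ.
have : (\int[P]_w (f \o Z') w = \int[P]_w (X w)%:E * \int[P]_w (Y w)%:E)%E.
  rewrite -(integral_distribution (P := P) (X := Z')) //.
  rewrite (eq_measure_integral (mu \x nu)%E); last first.
    by move=> A mA _; apply/esym; exact: munu.
  rewrite -integral12_prod_meas1//.
  rewrite -(integral_distribution (P := P) (X := X') (f := EFin)) //.
  rewrite -(integral_distribution (P := P) (X := Y') (f := EFin)) //.
  rewrite (eq_integral (fun x : R => x%:E * \int[nu]_y y%:E)%E); last first.
    by move=> x _; rewrite -integralZl.
  rewrite -/mu -/nu -(fineK (integrable_fin_num measurableT inu)).
  exact: integralZr.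
rewrite /Rintegral -fineM; first by move=> <-.
- by rewrite integrable_fin_num.
- by rewrite integrable_fin_num.
Qed.

End independence.

(** * The past of the two driving processes and its independence from the present *)

Section filtration.
Context (d : measure_display) (T : measurableType d) (R : realType)
  (P : probability T R).

Lemma sigma_ofP (m n : nat) (X : T -> 'M[R]_(m, n)) A :
  sigma_of X A <-> exists2 B, mx_borel R m n B & A = X @^-1` B.
Proof. by split=> [[B mB <-]|[B mB ->]]; exists B; rewrite ?setTI. Qed.

Lemma sigma_of_setT (m n : nat) (X : T -> 'M[R]_(m, n)) : sigma_of X setT.
Proof.
apply/sigma_ofP; exists setT => //.
exact: (@measurableT _ (g_sigma_algebraType _)).
Qed.

Lemma sigma_of_setI (m n : nat) (X : T -> 'M[R]_(m, n)) A B :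
  sigma_of X A -> sigma_of X B -> sigma_of X (A `&` B).
Proof.
move=> /sigma_ofP[A' mA ->] /sigma_ofP[B' mB ->]; apply/sigma_ofP.
exists (A' `&` B') => //; exact: (@measurableI _ (g_sigma_algebraType _)).
Qed.

Lemma mutually_independent_recr (F : nat -> set (set T)) (A : nat -> set T) t :
  mutually_independent P F -> (forall s, F s (A s)) ->
  P (\bigcap_(s < t.+1) A s) = (P (\bigcap_(s < t) A s) * P (A t))%E.
Proof.
move=> indF FA.
pose J k : {fset nat} := [fset i in iota 0 k]%fset.
have Jmem k i : (i \in J k) = (i < k)%N.
  by rewrite in_fset; exact: mem_iota.
have JE k : [set` J k] = `I_k.
  by apply/seteqP; split=> i /=; rewrite Jmem.
have JS : J t.+1 = (t |` J t)%fset.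
  by apply/fsetP => i; rewrite in_fsetU in_fset1 !Jmem ltnS leq_eqVlt.
have PE k : P (\bigcap_(s < k) A s) = (\prod_(s <- J k) P (A s))%E.
  by rewrite -(indF (J k) A) ?JE.
clearbody J; rewrite (PE t.+1) (PE t) JS big_fsetU1/=; last by rewrite Jmem ltnn.
by rewrite muleC.
Qed.

(** Measurability for the sub-sigma-algebra generated by [G], written with preimages because [T]
    already carries its full sigma-algebra. *)
Definition adapted (G : set (set T)) (f : T -> R) :=
  forall U, measurable U -> <<s G >> (f @^-1` U).

(** Through this view the closure properties of measurable functions (sums, products) become
    available for adapted ones. *)
Lemma adaptedP (G : set (set T)) (f : T -> R) :
  adapted G f <-> measurable_fun setT (f : g_sigma_algebraType G -> R).
Proof.
split=> [Gf _ U mU|mf U mU]; first by rewrite setTI; exact: Gf.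
by rewrite -[X in <<s _ >> X]setTI; exact: mf.
Qed.

Lemma adapted_sub (G H : set (set T)) (f : T -> R) :
  G `<=` <<s H >> -> adapted G f -> adapted H f.
Proof.
move=> GH Gf U mU; apply: (smallest_sub _ GH (Gf U mU)).
exact: smallest_sigma_algebra.
Qed.

Context (m n p q : nat).
Variables (L : nat -> T -> 'M[R]_(m, n)) (g : nat -> T -> 'M[R]_(p, q)).

(* The events determined by [L 0, ..., L (t - 1)] and [g 0, ..., g (t' - 1)],
   generated by a pi-system on which independence is a product formula. *)
Definition past (t t' : nat) : set (set T) := [set E |
  exists A B : nat -> set T,
    [/\ forall s, sigma_of (L s) (A s), forall s, sigma_of (g s) (B s) &
        E = \bigcap_(s < t) A s `&` \bigcap_(s < t') B s]].

Lemma past_setT t t' : past t t' setT.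
Proof.
exists (fun=> setT), (fun=> setT); split=> [s|s|]; try exact: sigma_of_setT.
by rewrite !bigcapT ?setIT.
Qed.

Lemma past_setI t t' : setI_closed (past t t').
Proof.
move=> _ _ [A [B [LA gB ->]]] [A' [B' [LA' gB' ->]]].
exists (fun s => A s `&` A' s), (fun s => B s `&` B' s); split=> [s|s|].
- exact: sigma_of_setI.
- exact: sigma_of_setI.
- by rewrite !bigcapI setIACA.
Qed.

Lemma past_L t t' s C : (s < t)%N -> sigma_of (L s) C -> past t t' C.
Proof.
move=> st LC; exists (fun r => if r == s then C else setT), (fun=> setT).
split=> [r|r|]; [by case: eqP => [->|_] //; exact: sigma_of_setT|
  exact: sigma_of_setT|].
rewrite [X in _ `&` X]bigcapT// setIT; apply/seteqP; split=> [w Cw r _/=|w].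
  by case: eqP.
by move=> /(_ s st); rewrite eqxx.
Qed.

Lemma past_g t t' s C : (s < t')%N -> sigma_of (g s) C -> past t t' C.
Proof.
move=> st gC; exists (fun=> setT), (fun r => if r == s then C else setT).
split=> [r|r|]; [exact: sigma_of_setT|
  by case: eqP => [->|_] //; exact: sigma_of_setT|].
rewrite [X in X `&` _]bigcapT// setTI; apply/seteqP; split=> [w Cw r _/=|w].
  by case: eqP.
by move=> /(_ s st); rewrite eqxx.
Qed.

Lemma past_sub t t' u u' : (t <= u)%N -> (t' <= u')%N -> past t t' `<=` past u u'.
Proof.
move=> tu tu' _ [A [B [LA gB ->]]].
exists (fun s => if (s < t)%N then A s else setT).
exists (fun s => if (s < t')%N then B s else setT).
split=> [s|s|].
- by case: ifP => _ //; exact: sigma_of_setT.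
- by case: ifP => _ //; exact: sigma_of_setT.
apply/seteqP; split=> w [Aw Bw]; split=> s /= sk.
- by case: ifP => // /Aw.
- by case: ifP => // /Bw.
- by have := Aw s (leq_trans sk tu); rewrite /= sk.
- by have := Bw s (leq_trans sk tu'); rewrite /= sk.
Qed.

Hypotheses (iidL : iid P L) (iidg : iid P g) (Lg : independent_processes P L g).

Lemma past_measurable t t' : past t t' `<=` measurable.
Proof.
move=> _ [A [B [LA gB ->]]]; case: iidL => mL _ _; case: iidg => mg _ _.
by apply: measurableI; apply: bigcap_measurableType => s _;
  [apply: (mL s)|apply: (mg s)].
Qed.

Lemma probability_past (A B : nat -> set T) t t' :
  (forall s, sigma_of (L s) (A s)) -> (forall s, sigma_of (g s) (B s)) ->
  P (\bigcap_(s < t) A s `&` \bigcap_(s < t') B s) =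
  (P (\bigcap_(s < t) A s) * P (\bigcap_(s < t') B s))%E.
Proof.
move=> LA gB; apply: Lg.
  apply: (@bigcap_measurableType _ (g_sigma_algebraType _)) => s _.
  by apply: sub_sigma_algebra; exists s.
apply: (@bigcap_measurableType _ (g_sigma_algebraType _)) => s _.
by apply: sub_sigma_algebra; exists s.
Qed.

(** The index pair [t.+1], [t] is that of the noise-free part of the update at time [t], which has
    seen [L t] but not yet [g t]. *)
Lemma past_indep_g t E C : <<s past t.+1 t >> E -> sigma_of (g t) C ->
  P (E `&` C) = (P E * P C)%E.
Proof.
move=> pE gC; have [mg ig _] := iidg.
apply: (indep_generated (@past_measurable t.+1 t)) pE.
- exact: (mg t C gC).
- exact: past_setI.
- exact: past_setT.
move=> _ [A [B [LA gB ->]]].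
(* Inserting [C] as the event of [g] at time [t] turns the intersection with [C] into one longer
   cylinder, whose probability factors. *)
pose B' s := if s == t then C else B s.
have gB' s : sigma_of (g s) (B' s) by rewrite /B'; case: eqP => // ->.
have B't : \bigcap_(s < t) B' s = \bigcap_(s < t) B s.
  by apply: eq_bigcapr => s /= st; rewrite /B' ltn_eqF.
have <- : \bigcap_(s < t.+1) A s `&` \bigcap_(s < t.+1) B' s =
    \bigcap_(s < t.+1) A s `&` \bigcap_(s < t) B s `&` C.
  rewrite -setIA; congr (_ `&` _).
  by rewrite IIS bigcap_setU bigcap_set1 B't {1}/B' eqxx.
rewrite !probability_past// (mutually_independent_recr _ ig gB') B't /B' eqxx.
by rewrite muleA.
Qed.

(** Here the past stops at [t] for both processes, as it does for the error at time [t]; [C] is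
    inserted as the event of [L] at time [t]. *)
Lemma past_indep_L t E C : <<s past t t >> E -> sigma_of (L t) C ->
  P (E `&` C) = (P E * P C)%E.
Proof.
move=> pE LC; have [mL iL _] := iidL.
apply: (indep_generated (@past_measurable t t)) pE.
- exact: (mL t C LC).
- exact: past_setI.
- exact: past_setT.
move=> _ [A [B [LA gB ->]]].
pose A' s := if s == t then C else A s.
have LA' s : sigma_of (L s) (A' s) by rewrite /A'; case: eqP => // ->.
have A't : \bigcap_(s < t) A' s = \bigcap_(s < t) A s.
  by apply: eq_bigcapr => s /= st; rewrite /A' ltn_eqF.
have <- : \bigcap_(s < t.+1) A' s `&` \bigcap_(s < t) B s =
    \bigcap_(s < t) A s `&` \bigcap_(s < t) B s `&` C.
  rewrite setIAC; congr (_ `&` _).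
  by rewrite IIS bigcap_setU bigcap_set1 A't {1}/A' eqxx.
rewrite !probability_past// (mutually_independent_recr _ iL LA') A't /A' eqxx.
by rewrite muleAC.
Qed.

End filtration.

(** * Deterministic bounds on quadratic forms *)

Section quadratic_forms.
Context (R : realType).

Lemma norm2_sqr (n : nat) (x : 'cV[R]_n) :
  norm2 x ^+ 2 = \sum_(i < n) x i 0 ^+ 2.
Proof. by rewrite sqr_sqrtr// sumr_ge0// => i _; exact: sqr_ge0. Qed.

Lemma quad_formE (n : nat) (A : 'M[R]_n) (y : 'cV[R]_n) :
  (y^T *m A *m y) 0 0 = \sum_(i < n) \sum_(j < n) A i j * (y i 0 * y j 0).
Proof.
rewrite -mulmxA mxE; apply: eq_bigr => i _; rewrite !mxE mulr_sumr.
by apply: eq_bigr => j _; ring.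
Qed.

Lemma quad_formE_col (n : nat) (A : 'M[R]_n) (y : 'cV[R]_n) :
  (y^T *m A *m y) 0 0 = \sum_(i < n) y i 0 * (A *m y) i 0.
Proof. by rewrite -mulmxA mxE; apply: eq_bigr => i _; rewrite mxE. Qed.

Lemma quad_form_lin (n : nat) (c : R) (A B : 'M[R]_n) (y : 'cV[R]_n) :
  (y^T *m (c *: A + B) *m y) 0 0 =
  c * (y^T *m A *m y) 0 0 + (y^T *m B *m y) 0 0.
Proof. by rewrite mulmxDr mulmxDl -scalemxAr -scalemxAl !mxE. Qed.

(** Cauchy-Schwarz against the constant vector: the double sum of [(f i - f j) ^+ 2] is nonnegative
    and equals twice the difference of the two sides. *)
Lemma sqr_sum_le (n : nat) (f : 'I_n -> R) :
  (\sum_i f i) ^+ 2 <= n%:R * \sum_i f i ^+ 2.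
Proof.
have : 0 <= \sum_i \sum_j (f i - f j) ^+ 2.
  by apply: sumr_ge0 => i _; apply: sumr_ge0 => j _; exact: sqr_ge0.
have -> : \sum_i \sum_j (f i - f j) ^+ 2 =
    n%:R * (\sum_i f i ^+ 2) - 2 * (\sum_i f i) ^+ 2 + n%:R * (\sum_i f i ^+ 2).
  have nE (c : R) : n%:R * c = \sum_(j < n) c.
    by rewrite sumr_const card_ord mulr_natl.
  have fE : (\sum_i f i) ^+ 2 = \sum_i \sum_j f i * f j.
    by rewrite expr2 mulr_suml; apply: eq_bigr => i _; rewrite mulr_sumr.
  rewrite fE [X in _ + X]nE mulr_sumr mulr_sumr -sumrB -big_split/=.
  apply: eq_bigr => i _.
  rewrite nE mulr_sumr -sumrB -big_split/=.
  by apply: eq_bigr => j _; ring.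
lra.
Qed.

Lemma mulmx_bounded (m n : nat) (K : 'M[R]_(m, n)) :
  exists2 C, 0 <= C & forall y : 'cV[R]_n,
    norm2 (K *m y) ^+ 2 <= C * norm2 y ^+ 2.
Proof.
(* The squared Frobenius norm. The extra factor [n] below comes from [sqr_sum_le] applied to each
   row. *)
pose S := \sum_i \sum_j K i j ^+ 2.
have K0 i j : 0 <= K i j ^+ 2 by exact: sqr_ge0.
have S0 : 0 <= S by apply: sumr_ge0 => i _; exact: sumr_ge0.
exists (n%:R * S) => [|y]; first by rewrite mulr_ge0.
rewrite !norm2_sqr -mulrA {1}/S mulr_suml mulr_sumr.
apply: ler_sum => i _; rewrite mxE; apply: (le_trans (sqr_sum_le _)).
rewrite ler_wpM2l// mulr_suml; apply: ler_sum => j _; rewrite exprMn.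
rewrite ler_wpM2l// (bigD1 j)//= lerDl; apply: sumr_ge0 => k _; exact: sqr_ge0.
Qed.

(** Expanding the square leaves [- 2 b q] plus a remainder, where [q] is the quadratic form of [A].
    The part of the remainder due to [A] is at most [2 b^2 kap q], so [q] keeps the coefficient
    [- 2 b (1 - b kap)], which is at most [- 2 al rho]. The surplus consensus gain is thus
    discarded, to match the fixed ratio [rho] of a coercivity assumption. *)
Lemma contraction_step (n : nat) (A K : 'M[R]_n) (y : 'cV[R]_n)
    (b al rho kap C : R) :
  0 <= (y^T *m A *m y) 0 0 ->
  norm2 (A *m y) ^+ 2 <= kap * (y^T *m A *m y) 0 0 ->
  norm2 (K *m y) ^+ 2 <= C * norm2 y ^+ 2 ->
  rho * al <= b * (1 - b * kap) ->
  norm2 (y - b *: (A *m y) - al *: (K *m y)) ^+ 2 <=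
  (1 + 2 * al ^+ 2 * C) * norm2 y ^+ 2 -
    2 * al * (y^T *m (rho *: A + K) *m y) 0 0.
Proof.
move=> A0 Akap KC rhob; rewrite quad_form_lin.
set q := _ 0 0 in A0 Akap *; set k := (y^T *m K *m y) 0 0.
have -> : norm2 (y - b *: (A *m y) - al *: (K *m y)) ^+ 2 =
    norm2 y ^+ 2 - 2 * b * q - 2 * al * k +
    \sum_i (b * (A *m y) i 0 + al * (K *m y) i 0) ^+ 2.
  rewrite !norm2_sqr /q /k !quad_formE_col !mulr_sumr -!sumrB -big_split/=.
  by apply: eq_bigr => i _; rewrite !mxE; ring.
(* The mixed terms are absorbed by [(p + q)^2 <= 2 p^2 + 2 q^2]. *)
have /le_trans H : \sum_i (b * (A *m y) i 0 + al * (K *m y) i 0) ^+ 2 <=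
    2 * b ^+ 2 * norm2 (A *m y) ^+ 2 + 2 * al ^+ 2 * norm2 (K *m y) ^+ 2.
  rewrite !norm2_sqr !mulr_sumr -big_split/=; apply: ler_sum => i _.
  by have := sqr_ge0 (b * (A *m y) i 0 - al * (K *m y) i 0); nra.
have b2 : 0 <= 2 * b ^+ 2 by rewrite mulr_ge0 ?sqr_ge0.
have al2 : 0 <= 2 * al ^+ 2 by rewrite mulr_ge0 ?sqr_ge0.
have {}Akap := ler_wpM2l b2 Akap; have {}KC := ler_wpM2l al2 KC.
have := ler_wpM2r A0 rhob.
have {}H := H _ (lerD Akap KC).
move: H; set s := \sum_i _; set Y := norm2 y ^+ 2; nra.
Qed.

End quadratic_forms.

(** Induction on [m t <= K / t]. Once [2 C <= t], the correction costs at most [1 / (2 (t+1))],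
    leaving the contraction factor [1 - (3/2) / (t+1)]. Since [3/2 > 1], a margin of order
    [K / (t (t+1))] remains to pay for the term in [D]. *)
Lemma stochastic_approx_rate (R : realType) (m : nat -> R) (C D : R) (t0 : nat) :
  (forall t, 0 <= m t) -> 0 <= D ->
  (forall t, (t0 <= t)%N ->
     m t.+1 <= (1 - 2 / t.+1%:R + C / t.+1%:R ^+ 2) * m t + D / t.+1%:R ^+ 2) ->
  exists K t1, forall t, (t1 <= t)%N -> m t <= K / t%:R.
Proof.
move=> m0 D0 mrec.
have [t2 Ct2] : exists t2 : nat, 2 * C <= t2%:R.
  exists (Num.bound `|2 * C|).
  by rewrite (le_trans (ler_norm _))// ltW// archi_boundP.
(* [1] keeps [t] invertible and the contraction factor nonnegative, [t0] validates the recursion,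
   [t2] tames the correction in [C]. *)
pose t1 := maxn 1 (maxn t0 t2).
have t11 : (1 <= t1)%N by rewrite leq_maxl.
have t10 : (t0 <= t1)%N by rewrite /t1 !leq_max leqnn orbT.
have t12 : (t2 <= t1)%N by rewrite /t1 !leq_max leqnn !orbT.
(* The second summand settles the base case; the first makes the margin [K / 2] cover [D] in the
   inductive step. *)
pose K := 2 * D + t1%:R * m t1.
exists K, t1 => t /subnK <-; elim: (t - t1)%N => [|k IH].
  rewrite add0n ler_pdivlMr ?ltr0n// /K mulrC lerDr mulr_ge0//.
set t' := (k + t1)%N in IH *; rewrite addSn -/t'.
have t't1 : (t1 <= t')%N by exact: leq_addl.
have t'1 : 1 <= t'%:R :> R by rewrite ler1n (leq_trans t11).
have Ct' : 2 * C <= t'%:R.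
  by rewrite (le_trans Ct2)// ler_nat (leq_trans t12).
have := mrec t' (leq_trans t10 t't1).
have : 0 <= K - 2 * D by rewrite /K addrC addKr mulr_ge0.
have := m0 t'; rewrite -(natr1 t').
move: (t'%:R) (m t') (m t'.+1) t'1 Ct' IH => s x x' s1 Cs xs x0 KD.
set u := (s + 1)^-1; set v := s^-1 in xs *.
have s0 : 0 < s by lra.
have u0 : 0 < u by rewrite invr_gt0; lra.
have v0 : 0 < v by rewrite invr_gt0.
have vE : s * v = 1 by rewrite divff ?gt_eqF.
have uE : (s + 1) * u = 1 by rewrite divff// gt_eqF//; lra.
(* That is, [1/s = 1/(s+1) + 1/(s (s+1))], which converts the bound at [s] into the one at
   [s + 1]. *)
have uv : v = u + u * v by nra.
have uv0 : 0 < u * v by exact: mulr_gt0.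
have Cu : C * u ^+ 2 <= u / 2 by nra.
rewrite -exprVn -/u => H.
have {}H : x' <= (1 - 3 / 2 * u) * x + D * u ^+ 2.
  by have := ler_wpM2r x0 Cu; lra.
have u2 : 0 <= 1 - 3 / 2 * u by nra.
have Hx := ler_wpM2l u2 xs.
have Du : D * u ^+ 2 <= D * (u * v).
  by rewrite ler_wpM2l// expr2 ler_wpM2l ?ltW//; lra.
have Kuv : 0 <= (K - 2 * D) * (u * v) by rewrite mulr_ge0// ltW.
have E : (1 - 3 / 2 * u) * (K * v) = K * u - K * (u * v) / 2.
  have : K * v = K * u + K * (u * v) by rewrite {1}uv mulrDr.
  lra.
lra.
Qed.

(** * Mean-square analysis of an abstract consensus-plus-innovations recursion *)

Section consensus_innovations.
Context (d : measure_display) (T : measurableType d) (R : realType)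
  (P : probability T R) (m n q D : nat).
Variables (L : nat -> T -> 'M[R]_(m, n)) (g : nat -> T -> 'cV[R]_q).
Hypotheses (iidL : iid P L) (iidg : iid P g) (Lg : independent_processes P L g).
(** [F] stands for [LP I]. Kept abstract, it enters only through measurable bounded entries and a
    nonnegative quadratic form that controls [|F y|^2]. *)
Variables (F : 'M[R]_(m, n) -> 'M[R]_D) (C kap : R).
Hypothesis mF : forall i j U, measurable U ->
  mx_borel R m n [set A | U (F A i j)].
Hypothesis F_le : forall t w i j, `|F (L t w) i j| <= C.
Hypothesis F_ge0 : forall t w (y : 'cV[R]_D),
  0 <= (y^T *m F (L t w) *m y) 0 0.
Hypothesis F_kap : forall t w (y : 'cV[R]_D),
  norm2 (F (L t w) *m y) ^+ 2 <= kap * (y^T *m F (L t w) *m y) 0 0.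
Variables (v : 'I_q -> R).
Hypothesis g_L2 : forall t i, L2 P (fun w => g t w i 0).
Hypothesis g_mean : forall t i, (\int[P]_w g t w i 0)%R = 0.
Hypothesis g_var : forall t i, (\int[P]_w (g t w i 0 ^+ 2))%R = v i.
Variables (b al : nat -> R) (rho c1 : R) (K : 'M[R]_D) (B : 'M[R]_(D, q)).
Hypothesis al_ge0 : forall t, 0 <= al t.
Variables (e : nat -> T -> 'cV[R]_D) (e0 : 'cV[R]_D).
Hypothesis e_init : forall w, e 0%N w = e0.
Hypothesis e_rec : forall t w, e t.+1 w =
  e t w - b t *: (F (L t w) *m e t w) - al t *: (K *m e t w) +
  al t *: (B *m g t w).
(** Coercivity is that of the mean matrix, as a single graph may be disconnected. It is asked only
    along the error, because A5 holds only on the range of [Pmx]. *)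
Hypothesis e_coercive : forall t w, c1 * norm2 (e t w) ^+ 2 <=
  ((e t w)^T *m (rho *: mean_mx P (fun w => F (L 0%N w)) + K) *m e t w) 0 0.

(** The update before the new noise enters: it depends on [L] up to time [t] but on [g] only up to
    [t - 1], hence is independent of [g t]. *)
Let u t w := e t w - b t *: (F (L t w) *m e t w) - al t *: (K *m e t w).

Lemma sigma_of_comp t i j U : measurable U ->
  sigma_of (L t) ((fun w => F (L t w) i j) @^-1` U).
Proof.
by move=> mU; apply/sigma_ofP; exists [set A | U (F A i j)]; [exact: mF|].
Qed.

Lemma sigma_of_g t i U : measurable U ->
  sigma_of (g t) ((fun w => g t w i 0) @^-1` U).
Proof.
move=> mU; apply/sigma_ofP; exists [set x : 'cV[R]_q | U (x i 0)] => //.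
by apply: sub_sigma_algebra; exists i, 0, U.
Qed.

Lemma adapted_F t t' s i j : (s < t)%N ->
  adapted (past L g t t') (fun w => F (L s w) i j).
Proof.
move=> st U mU; apply: sub_sigma_algebra.
by apply: (past_L _ _ st); exact: sigma_of_comp.
Qed.

Lemma adapted_g t t' s i : (s < t')%N ->
  adapted (past L g t t') (fun w => g s w i 0).
Proof.
move=> st U mU; apply: sub_sigma_algebra.
by apply: (past_g _ _ st); exact: sigma_of_g.
Qed.

Lemma adapted_past_sub t t' s s' (f : T -> R) : (t <= s)%N -> (t' <= s')%N ->
  adapted (past L g t t') f -> adapted (past L g s s') f.
Proof.
move=> ts ts'; apply: adapted_sub => A pA; apply: sub_sigma_algebra.
exact: past_sub pA.
Qed.

Lemma adapted_measurable t t' (f : T -> R) : adapted (past L g t t') f ->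
  measurable_fun setT f.
Proof.
move=> af _ U mU; rewrite setTI.
apply: (smallest_sub _ _ (af U mU)); first exact: sigma_algebra_measurable.
exact: (past_measurable iidL iidg).
Qed.

Lemma u_entryE t w i : u t w i 0 = e t w i 0 -
  b t * (\sum_j F (L t w) i j * e t w j 0) - al t * (\sum_j K i j * e t w j 0).
Proof. by rewrite /u !mxE. Qed.

Lemma e_entryE t w i : e t.+1 w i 0 = u t w i 0 +
  al t * (\sum_k B i k * g t w k 0).
Proof. by rewrite e_rec -/(u t w) !mxE. Qed.

Lemma adapted_u t : (forall i, adapted (past L g t t) (fun w => e t w i 0)) ->
  forall i, adapted (past L g t.+1 t) (fun w => u t w i 0).
Proof.
move=> ae i; under eq_fun do rewrite u_entryE.
have {}ae j : measurable_fun setT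
    ((fun w => e t w j 0) : g_sigma_algebraType (past L g t.+1 t) -> R).
  by apply/adaptedP; apply: adapted_past_sub (ae j).
apply/adaptedP; apply: measurable_funB; first apply: measurable_funB => //.
- apply: measurable_funM => //; apply: measurable_sum => j.
  apply: measurable_funM => //; apply/adaptedP; exact: adapted_F.
- apply: measurable_funM => //; apply: measurable_sum => j.
  exact: measurable_funM.
Qed.

Lemma adapted_e t i : adapted (past L g t t) (fun w => e t w i 0).
Proof.
elim: t i => [|t IH] i.
  by apply/adaptedP; under eq_fun do rewrite e_init; exact: measurable_cst.
under eq_fun do rewrite e_entryE.
apply/adaptedP; apply: measurable_funD.
  by apply/adaptedP; apply: adapted_past_sub (adapted_u IH i).
apply: measurable_funM => //; apply: measurable_sum => k.
apply: measurable_funM => //; apply/adaptedP; exact: adapted_g.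
Qed.

Lemma measurable_F t i j : measurable_fun setT (fun w => F (L t w) i j).
Proof. exact: (adapted_measurable (@adapted_F t.+1 0 t i j (ltnSn t))). Qed.

(** The random coefficients are bounded by [C], so multiplying by them preserves square
    integrability. *)
Lemma L2_u t : (forall i, L2 P (fun w => e t w i 0)) ->
  forall i, L2 P (fun w => u t w i 0).
Proof.
move=> le i; under [X in L2 _ X]eq_fun do rewrite u_entryE.
apply: L2D; last first.
  under [X in L2 _ X]eq_fun do rewrite -mulNr.
  by apply: L2Z; apply: L2_sum => j; exact: L2Z.
apply: L2D => //; under [X in L2 _ X]eq_fun do rewrite -mulNr.
apply: L2Z; apply: L2_sum => j; apply: (L2_boundedM (C := C)) => //.
exact: measurable_F.
Qed.

Lemma L2_Bg t i : L2 P (fun w => al t * (\sum_k B i k * g t w k 0)).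
Proof. by apply: L2Z; apply: L2_sum => k; exact: L2Z. Qed.

Lemma L2_e t i : L2 P (fun w => e t w i 0).
Proof.
elim: t i => [|t IH] i.
  by under [X in L2 _ X]eq_fun do rewrite e_init; exact: L2_cst.
under [X in L2 _ X]eq_fun do rewrite e_entryE.
by apply: L2D; [exact: L2_u|exact: L2_Bg].
Qed.

Lemma F_L1 t i j : L1 P (fun w => F (L t w) i j).
Proof.
apply: (@L1_le _ _ _ _ _ (fun=> C)); [exact: measurable_F| |exact: L1_cst].
by move=> w; rewrite (le_trans (F_le _ _ _ _))// ler_norm.
Qed.

(** [L t] and [L 0] have the same law, so both integrals are taken against the same pushforward
    measure. *)
Lemma F_mean t i j :
  (\int[P]_w F (L t w) i j)%R = mean_mx P (fun w => F (L 0%N w)) i j.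
Proof.
rewrite mxE unlock; congr fine.
pose X s : {mfun T >-> R} := mfun_Sub (mem_set (measurable_F s i j)).
rewrite -(integral_distribution (P := P) (X := X t) (f := EFin))//; last first.
  exact: F_L1.
rewrite -(integral_distribution (P := P) (X := X 0%N) (f := EFin))//; last first.
  exact: F_L1.
apply: eq_measure_integral => U mU _; have [_ _ idL] := iidL.
by rewrite /distribution /pushforward/=; exact: (idL t _ (mF i j mU)).
Qed.

(** In the expansion over entries, each [F (L t w) i j] is independent of [e_i * e_j], a function of
    the strict past, so each expectation factors. *)
Lemma F_quad_mean t :
  L1 P (fun w => ((e t w)^T *m F (L t w) *m e t w) 0 0) /\
  (\int[P]_w ((e t w)^T *m F (L t w) *m e t w) 0 0)%R =
  (\int[P]_w ((e t w)^T *m mean_mx P (fun w => F (L 0%N w)) *m e t w) 0 0)%R.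
Proof.
have lee i j := L2M (L2_e t i) (L2_e t j).
have indep i j := indep_integralM (F_L1 t i j) (lee i j) _.
have {}indep i j : L1 P (fun w => F (L t w) i j * (e t w i 0 * e t w j 0)) /\
  (\int[P]_w (F (L t w) i j * (e t w i 0 * e t w j 0)))%R =
  (\int[P]_w (mean_mx P (fun w => F (L 0%N w)) i j *
              (e t w i 0 * e t w j 0)))%R.
  rewrite RintegralZl; [rewrite -(F_mean t i j)|by []|exact: lee].
  apply: indep => {}i {}j U V mU mV; rewrite setIC [RHS]muleC.
  apply: (past_indep_L iidL iidg Lg); last exact: sigma_of_comp.
  suff : adapted (past L g t t) (fun w => e t w i 0 * e t w j 0) by exact.
  by apply/adaptedP; apply: measurable_funM; apply/adaptedP; exact: adapted_e.
under [X in L1 P X]eq_fun do rewrite quad_formE.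
split; first by apply: L1_sum => i; apply: L1_sum => j; case: (indep i j).
under eq_Rintegral do rewrite quad_formE.
under [RHS]eq_Rintegral do rewrite quad_formE.
rewrite !Rintegral_sum_fin; last 2 first.
- by move=> i; apply: L1_sum => j; apply: L1Z; exact: lee.
- by move=> i; apply: L1_sum => j; case: (indep i j).
apply: eq_bigr => i _; rewrite !Rintegral_sum_fin; last 2 first.
- by move=> j; apply: L1Z; exact: lee.
- by move=> j; case: (indep i j).
by apply: eq_bigr => j _; case: (indep i j).
Qed.

Lemma u_g_uncorrelated t i k :
  L1 P (fun w => u t w i 0 * g t w k 0) /\
  (\int[P]_w (u t w i 0 * g t w k 0))%R = 0.
Proof.
rewrite -(mulr0 (\int[P]_w (u t w i 0))%R) -(g_mean t k).
apply: indep_integralM; [exact/L2_L1/L2_u/L2_e|exact/L2_L1/g_L2|].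
move=> U V mU mV; apply: (past_indep_g iidL iidg Lg).
  exact: (adapted_u (@adapted_e t) i mU).
exact: sigma_of_g.
Qed.

Lemma L1_norm2 (p : nat) (f : T -> 'cV[R]_p) :
  (forall i, L2 P (fun w => f w i 0)) -> L1 P (fun w => norm2 (f w) ^+ 2).
Proof.
move=> lf; under [X in L1 P X]eq_fun do rewrite norm2_sqr.
by apply: L1_sum => i; case: (lf i).
Qed.

(** The constants are uniform in [t]; the side condition on the gains is the one of
    [contraction_step]. *)
Lemma mean_square_step : exists C1 C2, [/\ 0 <= C2 & forall t,
  rho * al t <= b t * (1 - b t * kap) ->
  (\int[P]_w (norm2 (e t.+1 w) ^+ 2))%R <=
  (1 - 2 * c1 * al t + C1 * al t ^+ 2) * (\int[P]_w (norm2 (e t w) ^+ 2))%R +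
  C2 * al t ^+ 2].
Proof.
have [CK CK0 KCK] := mulmx_bounded K; have [CB CB0 BCB] := mulmx_bounded B.
exists (2 * CK), (CB * \sum_i v i); split=> [|t rhob].
  rewrite mulr_ge0// sumr_ge0// => i _; rewrite -(g_var 0%N).
  by apply: Rintegral_ge0 => w _; exact: sqr_ge0.
pose Ab := mean_mx P (fun w => F (L 0%N w)).
have l1e := L1_norm2 (@L2_e t).
have l1u := L1_norm2 (L2_u (@L2_e t)).
have l1g := L1_norm2 (g_L2 t).
(* The inner product of [u t w] with the injected noise; it has mean zero. *)
pose cross w := \sum_i \sum_k al t * B i k * (u t w i 0 * g t w k 0).
have l1c : L1 P cross.
  apply: L1_sum => i; apply: L1_sum => k; apply: L1Z.
  by case: (u_g_uncorrelated t i k).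
have cross0 : (\int[P]_w cross w)%R = 0.
  rewrite Rintegral_sum_fin => [|i]; last first.
    by apply: L1_sum => k; apply: L1Z; case: (u_g_uncorrelated t i k).
  apply: big1 => i _; rewrite Rintegral_sum_fin => [|k]; last first.
    by apply: L1Z; case: (u_g_uncorrelated t i k).
  apply: big1 => k _; have [l1 E] := u_g_uncorrelated t i k.
  by rewrite RintegralZl// E mulr0.
have step1 : (\int[P]_w (norm2 (e t.+1 w) ^+ 2))%R <=
    (\int[P]_w (norm2 (u t w) ^+ 2))%R + CB * (\sum_i v i) * al t ^+ 2.
  have <- : (\int[P]_w (norm2 (g t w) ^+ 2))%R = \sum_i v i.
    under eq_Rintegral do rewrite norm2_sqr.
    rewrite Rintegral_sum_fin => [|i]; last by case: (g_L2 t i).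
    by apply: eq_bigr => i _; exact: g_var.
  (* Adding the null term [2 * cross] under the integral makes the comparison pointwise. *)
  have -> : (\int[P]_w (norm2 (u t w) ^+ 2))%R = (\int[P]_w
     (norm2 (u t w) ^+ 2 + 2 * cross w))%R.
    rewrite RintegralD//; last exact: L1Z.
    by rewrite RintegralZl// cross0 mulr0 addr0.
  rewrite mulrAC -RintegralZl// -RintegralD//; last 2 first.
  - by apply: L1D => //; exact: L1Z.
  - exact: L1Z.
  apply: le_Rintegral => //.
  - exact: (L1_norm2 (@L2_e t.+1)).
  - by apply: L1D; [apply: L1D => //; exact: L1Z|exact: L1Z].
  move=> w _.
  have -> : norm2 (e t.+1 w) ^+ 2 = norm2 (u t w) ^+ 2 + 2 * cross w +
      al t ^+ 2 * norm2 (B *m g t w) ^+ 2.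
    rewrite !norm2_sqr /cross mulr_sumr [al t ^+ 2 * _]mulr_sumr -!big_split/=.
    apply: eq_bigr => i _.
    rewrite e_entryE; set S := \sum_k B i k * g t w k 0.
    have -> : (B *m g t w) i 0 = S by rewrite mxE.
    have -> : \sum_k al t * B i k * (u t w i 0 * g t w k 0) =
        al t * u t w i 0 * S.
      by rewrite /S mulr_sumr; apply: eq_bigr => k _; ring.
    ring.
  by rewrite lerD2l [leRHS]mulrAC [leRHS]mulrC ler_wpM2l ?sqr_ge0.
apply: (le_trans step1); rewrite lerD2r.
have [l1q Eq] := F_quad_mean t.
have l1quad (M : 'M[R]_D) : L1 P (fun w => ((e t w)^T *m M *m e t w) 0 0).
  under [X in L1 P X]eq_fun do rewrite quad_formE.
  apply: L1_sum => i; apply: L1_sum => j; apply: L1Z.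
  exact: L2M (L2_e _ _) (L2_e _ _).
have l1r : L1 P (fun w => ((e t w)^T *m (rho *: F (L t w) + K) *m e t w) 0 0).
  under [X in L1 P X]eq_fun do rewrite quad_form_lin.
  by apply: L1D; [exact: L1Z|exact: l1quad].
(* The contraction is applied pathwise, with the random matrix still in place, and then
   integrated. *)
have step2 : (\int[P]_w (norm2 (u t w) ^+ 2))%R <=
   (1 + 2 * al t ^+ 2 * CK) * (\int[P]_w (norm2 (e t w) ^+ 2))%R - 2 * al t *
   (\int[P]_w ((e t w)^T *m (rho *: F (L t w) + K) *m e t w) 0 0)%R.
  rewrite -!RintegralZl// -RintegralB//; [|exact: L1Z|exact: L1Z].
  apply: le_Rintegral => //.
    by apply: L1B; exact: L1Z.
  by move=> w _; apply: contraction_step => //.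
apply: (le_trans step2).
(* Only after integration can the random matrix be exchanged for its mean, for which coercivity is
   known. *)
have step3 : c1 * (\int[P]_w (norm2 (e t w) ^+ 2))%R <=
   (\int[P]_w ((e t w)^T *m (rho *: F (L t w) + K) *m e t w) 0 0)%R.
  have -> : (\int[P]_w ((e t w)^T *m (rho *: F (L t w) + K) *m e t w) 0 0)%R =
     (\int[P]_w ((e t w)^T *m (rho *: Ab + K) *m e t w) 0 0)%R.
    under eq_Rintegral do rewrite quad_form_lin.
    under [RHS]eq_Rintegral do rewrite quad_form_lin.
    rewrite !RintegralD//; [|exact: L1Z|exact: l1quad|exact: L1Z|exact: l1quad].
    rewrite (RintegralZl _ measurableT l1q) Eq.
    by rewrite (RintegralZl _ measurableT (l1quad _)).
  rewrite -RintegralZl//; apply: le_Rintegral => //; first exact: (L1Z c1 l1e).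
  exact: l1quad.
have := ler_wpM2l (al_ge0 t) step3.
set I1 := (\int[P]_w _)%R; set I2 := (\int[P]_w _)%R; lra.
Qed.

End consensus_innovations.

(** On the [j]-th basis vector the hypothesis bounds the squared norm of column [j] by
    [kap * F j j]. In particular [F j j ^+ 2 <= kap * F j j], so [F j j <= kap], and every entry of
    the column follows. *)
Lemma entry_le_psd (R : realType) (n : nat) (F : 'M[R]_n) (kap : R) :
  0 <= kap -> (forall y : 'cV[R]_n, 0 <= (y^T *m F *m y) 0 0) ->
  (forall y : 'cV[R]_n,
     norm2 (F *m y) ^+ 2 <= kap * (y^T *m F *m y) 0 0) ->
  forall i j, `|F i j| <= kap.
Proof.
move=> kap0 F0 Fkap i j; have := F0 (delta_mx j 0); have := Fkap (delta_mx j 0).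
rewrite -mulmxA -colE trmx_delta -rowE !mxE norm2_sqr => FE Fj.
have Fk k : F k j ^+ 2 <= kap * F j j.
  apply: le_trans FE; rewrite (bigD1 k)//= mxE lerDl.
  by apply: sumr_ge0 => l _; exact: sqr_ge0.
have Fjj : F j j <= kap by have := Fk j; nra.
rewrite -(@ler_pXn2r _ 2)// ?nnegrE// real_normK ?num_real//.
by rewrite (le_trans (Fk i))// ler_wpM2l.
Qed.

(** * The masked Laplacian of one graph, coordinate by coordinate *)

Section masked_laplacian.
Context (R : realType) (N : nat) (I : 'I_N -> {set 'I_N}).
Notation blocks := (\sum_(n < N) N)%N.

Lemma proj_mulE (S : {set 'I_N}) (p : nat) (A : 'M[R]_(N, p)) i j :
  (proj_mx_of R S *m A) i j = (i \in S)%:R * A i j.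
Proof. by rewrite /proj_mx_of mul_diag_mx !mxE. Qed.

Lemma submxcol_Pmx (y : 'cV[R]_blocks) n i :
  submxcol (Pmx R I *m y) n i 0 = (i \in I n)%:R * submxcol y n i 0.
Proof.
by rewrite -{1}[y]submxcolK /Pmx mul_mxdiag_mxcol mxcolK proj_mulE.
Qed.

Lemma norm2_submxcol (y : 'cV[R]_blocks) :
  norm2 y ^+ 2 = \sum_n \sum_i submxcol y n i 0 ^+ 2.
Proof.
rewrite norm2_sqr.
have -> : \sum_k y k 0 ^+ 2 = (y^T *m y) 0 0.
  by rewrite mxE; apply: eq_bigr => k _; rewrite mxE.
rewrite -{1 2}[y]submxcolK tr_mxcol mul_mxrow_mxcol summxE.
by apply: eq_bigr => n _; rewrite mxE; apply: eq_bigr => i _; rewrite mxE.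
Qed.

Lemma bilin_submxcol (y z : 'cV[R]_blocks) :
  (y^T *m z) 0 0 = \sum_n \sum_i submxcol y n i 0 * submxcol z n i 0.
Proof.
rewrite -{1}[y]submxcolK -{1}[z]submxcolK tr_mxcol mul_mxrow_mxcol summxE.
by apply: eq_bigr => n _; rewrite mxE; apply: eq_bigr => i _; rewrite !mxE.
Qed.

Variable e : rel 'I_N.
Hypotheses (e_sym : symmetric e) (e_irr : irreflexive e).

(* The edges along which coordinate [i] is exchanged. *)
Let wt i n l : R := [&& e n l, i \in I n & i \in I l]%:R.

(** Off-diagonal Laplacian entries are [- e n l]: the diagonal block collects the weights on agent
    [n], the others subtract the neighbours. The term [l = n] on the right vanishes by itself. *)
Lemma submxcol_LP (y : 'cV[R]_blocks) n i :
  submxcol (LP I (laplacian R e) *m y) n i 0 =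
  \sum_l wt i n l * (submxcol y n i 0 - submxcol y l i 0).
Proof.
have LE l : l != n -> laplacian R e n l = - (e n l)%:R.
  by move=> ln; rewrite !mxE eq_sym (negbTE ln) mulr0n add0r.
rewrite -{1}[y]submxcolK /LP mxblockEv mxcol_mul mxcolK mul_mxrow_mxcol summxE.
rewrite (bigD1 n)//= eqxx mulNmx mxE -mulmxA proj_mulE mulmx_suml summxE.
rewrite [RHS](bigD1 n)//= subrr mulr0 add0r mulr_sumr -sumrN -big_split/=.
have sc (c : R) (A : 'cV[R]_N) : (c *: A) i 0 = c * A i 0 by rewrite mxE.
apply: eq_bigr => l ln; rewrite eq_sym (negbTE ln) -!scalemxAl !sc.
rewrite -mulmxA !proj_mulE LE// /wt.
by case: (e n l); case: (i \in I n); case: (i \in I l) => /=; ring.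
Qed.

Lemma wt_sym i n l : wt i n l = wt i l n.
Proof. by rewrite /wt e_sym [X in _ && X]andbC. Qed.

(** The Dirichlet form of a weighted graph, obtained by adding to the quadratic form its copy with
    [n] and [l] exchanged; hence the factor 2. *)
Lemma LP_quad_form (y : 'cV[R]_blocks) :
  2 * (y^T *m LP I (laplacian R e) *m y) 0 0 =
  \sum_n \sum_i \sum_l wt i n l * (submxcol y n i 0 - submxcol y l i 0) ^+ 2.
Proof.
rewrite -mulmxA bilin_submxcol exchange_big [RHS]exchange_big/= mulr_sumr.
apply: eq_bigr => i _; pose Y n := submxcol y n i 0.
under eq_bigr do rewrite submxcol_LP.
rewrite mulrDl mul1r; set S := \sum_n _.
transitivity (\sum_n \sum_l wt i n l * (Y n * (Y n - Y l)) +
              \sum_n \sum_l wt i n l * (Y l * (Y l - Y n))).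
  have SE : S = \sum_n \sum_l wt i n l * (Y n * (Y n - Y l)).
    apply: eq_bigr => n _; rewrite mulr_sumr; apply: eq_bigr => l _.
    by rewrite mulrCA.
  rewrite {1}SE; congr (_ + _); rewrite SE exchange_big/=.
  by apply: eq_bigr => n _; apply: eq_bigr => l _; rewrite wt_sym.
rewrite -big_split/=; apply: eq_bigr => n _; rewrite -big_split/=.
by apply: eq_bigr => l _; rewrite /Y; ring.
Qed.

Lemma LP_ge0 (y : 'cV[R]_blocks) :
  0 <= (y^T *m LP I (laplacian R e) *m y) 0 0.
Proof.
rewrite -(@pmulr_rge0 _ 2)// LP_quad_form.
apply: sumr_ge0 => n _; apply: sumr_ge0 => i _; apply: sumr_ge0 => l _.
by rewrite mulr_ge0 ?sqr_ge0.
Qed.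

(** Cauchy-Schwarz over the [N] agents gives the factor [N]; weights in {0, 1} equal their squares,
    and the 2 is that of [LP_quad_form]. *)
Lemma LP_norm2_le (y : 'cV[R]_blocks) :
  norm2 (LP I (laplacian R e) *m y) ^+ 2 <=
  (2 * N%:R) * (y^T *m LP I (laplacian R e) *m y) 0 0.
Proof.
rewrite (mulrC 2) -mulrA LP_quad_form norm2_submxcol mulr_sumr.
apply: ler_sum => n _; rewrite mulr_sumr; apply: ler_sum => i _.
rewrite submxcol_LP; apply: (le_trans (sqr_sum_le _)).
rewrite ler_wpM2l//; apply: ler_sum => l _; rewrite exprMn.
by rewrite /wt; case: [&& _, _ & _]; rewrite ?expr1n ?expr0n.
Qed.

Lemma Pmx_LP (y : 'cV[R]_blocks) :
  Pmx R I *m (LP I (laplacian R e) *m y) = LP I (laplacian R e) *m y.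
Proof.
apply/mxcolP => n; apply/colP => i; rewrite submxcol_Pmx submxcol_LP mulr_sumr.
apply: eq_bigr => l _; rewrite mulrA; congr (_ * _).
rewrite /wt; case: (e n l); case: (i \in I n);
  by rewrite /= ?(mul1r, mulr0, mul0r).
Qed.

(** A weight is nonzero only if both agents are interested in coordinate [i], and then both hold the
    same value [theta i]. *)
Lemma LP_consensus (theta : 'cV[R]_N) :
  LP I (laplacian R e) *m (Pmx R I *m \mxcol_(n < N) theta) = 0.
Proof.
apply/mxcolP => n; apply/colP => i; rewrite submxcol_LP submxcol0 [RHS]mxE.
apply: big1 => l _; rewrite !submxcol_Pmx !mxcolK /wt.
case: (e n l); case: (i \in I n); case: (i \in I l);
  by rewrite /= ?mul0r ?subrr ?mulr0.
Qed.

End masked_laplacian.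

(** * Measurability of the masked Laplacian, noise moments, and comparison of the weights *)

Lemma mx_borel_entry (R : realType) (m n : nat) i j :
  measurable_fun setT
    ((fun A : 'M[R]_(m, n) => A i j) : g_sigma_algebraType
       [set B | exists (i : 'I_m) (j : 'I_n) (A : set R),
         measurable A /\ B = [set x : 'M[R]_(m, n) | A (x i j)]] -> R).
Proof.
move=> _ U mU; rewrite setTI; apply: sub_sigma_algebra.
by exists i, j, U.
Qed.

Lemma measurable_LP (R : realType) (N : nat) (I : 'I_N -> {set 'I_N}) i j U :
  measurable U -> mx_borel R N N [set A | U (LP I A i j)].
Proof.
move=> mU; rewrite -[X in mx_borel _ _ _ X]setTI.
suff mLP : measurable_fun setT ((fun A => LP I A i j) : g_sigma_algebraType
       [set B | exists (i : 'I_N) (j : 'I_N) (A : set R),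
         measurable A /\ B = [set x : 'M[R]_(N, N) | A (x i j)]] -> R).
  exact: mLP.
have sc c (B : 'M[R]_N) k l : (c *: B) k l = c * B k l by rewrite mxE.
(* A stacked index is decoded into its block and its position in the block, exhibiting the entry as
   a finite linear combination of entries of [A]. *)
pose n := tagnat.sig1 i; pose l := tagnat.sig1 j.
pose i' : 'I_N := tagnat.sig2 i; pose j' : 'I_N := tagnat.sig2 j.
pose f (A : 'M[R]_N) := if n == l
    then - ((i' \in I n)%:R * \sum_(r < N) if r != n
           then A n r * proj_mx_of R (I r) i' j' else 0)
    else A n l *
         (proj_mx_of R (I l) *m proj_mx_of R (I n)) i' j'.
have -> : (fun A => LP I A i j) = f.
  apply/funext => A; rewrite /f /LP /mxblock mxE -/n -/l -/i' -/j'.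
  case: eqP => [_|_]; last by rewrite sc.
  rewrite mxE proj_mulE summxE -big_mkcond/=; congr (- (_ * _)).
  by apply: eq_bigr => r _; rewrite sc.
rewrite /f; case: (n == l); last first.
  by apply: measurable_funM => //; exact: mx_borel_entry.
apply: measurableT_comp => //; apply: measurable_funM => //.
apply: measurable_sum => r; case: (r != n) => //.
by apply: measurable_funM => //; exact: mx_borel_entry.
Qed.

(** For centered [X] the covariance is the integral of [X ^+ 2]; its being a real number is what
    yields square integrability. *)
Lemma centered_second_moment (d : measure_display) (T : measurableType d)
    (R : realType) (P : probability T R) (X : T -> R) (r : R) :
  measurable_fun setT X -> ('E_P[X] = 0)%E -> covariance P X X = r%:E ->
  [/\ L2 P X, (\int[P]_w X w)%R = 0 & (\int[P]_w (X w ^+ 2))%R = r].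
Proof.
move=> mX EX; rewrite unlock EX/= unlock.
have -> : (X \- cst 0) * (X \- cst 0) = (fun w => X w ^+ 2).
  by apply/funext => w; rewrite !fctE /= subr0 expr2.
move=> VX; split.
- split => //; apply/integrableP; split.
    by apply/measurable_EFinP; exact: measurable_funX.
  under eq_integral do rewrite /= ger0_norm ?sqr_ge0//.
  by rewrite VX ltry.
- by move: EX; rewrite unlock /Rintegral => ->.
- by rewrite /Rintegral VX.
Qed.

Lemma powR_ge_near (R : realType) (eta M : R) : 0 < eta ->
  exists t0, forall t, (t0 <= t)%N -> M <= t.+1%:R `^ eta.
Proof.
move=> eta0; exists (Num.bound (`|M| `^ eta^-1)) => t t0t.
rewrite (le_trans (ler_norm _))//.
have E : `|M| = (`|M| `^ eta^-1) `^ eta.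
  by rewrite -powRrM mulVf ?lt0r_neq0// powRr1.
rewrite [leLHS]E.
apply: ge0_ler_powR; rewrite ?nnegrE ?powR_ge0 ?(ltW eta0)//.
have := archi_boundP (powR_ge0 `|M| eta^-1); move=> /ltW /le_trans; apply.
by rewrite ler_nat ltnW.
Qed.

(** With [s = t + 1] and [p = s^delta1] the claim reads [p^2 <= s (p - beta0 kap)]. For large [t],
    [p >= 2 beta0 kap] makes the bracket at least [p / 2], and [s >= 2 p] concludes. *)
Lemma innovation_gain_dominated (R : realType) (beta0 delta1 kap : R) :
  0 < beta0 -> 0 < delta1 -> delta1 < 1 -> exists t0, forall t, (t0 <= t)%N ->
    beta0 / t.+1%:R <=
    beta beta0 delta1 t * (1 - beta beta0 delta1 t * kap).
Proof.
move=> beta0_gt0 d0 d1.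
have [t1 t1P] := powR_ge_near (2 * beta0 * kap) d0.
have [t2 t2P] := @powR_ge_near R (1 - delta1) 2 ltac:(lra).
exists (maxn t1 t2) => t; rewrite geq_max => /andP[/t1P H1 /t2P H2].
rewrite /beta; set s : R := t.+1%:R in H1 H2 *.
have s0 : 0 < s by rewrite ltr0n.
set p := s `^ delta1 in H1 *; have p0 : 0 < p by exact: powR_gt0.
have E : s = p * s `^ (1 - delta1).
  by rewrite -powRD ?subrKC ?powRr1 ?(ltW s0)// gt_eqF ?implybT.
have sp : 2 * p <= s by rewrite [leRHS]E mulrC ler_wpM2l// ltW.
have -> : beta0 / p * (1 - beta0 / p * kap) = beta0 * (p - beta0 * kap) / p ^+ 2.
  by field; rewrite gt_eqF.
rewrite -!mulrA ler_wpM2l ?(ltW beta0_gt0)// ler_pdivlMr ?exprn_gt0//.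
rewrite mulrC ler_pdivrMr//.
nra.
Qed.

(** Masking [theta] by [I n] does not affect the observation, because the columns of [H n] outside
    [I n] vanish. *)
Lemma GH_tr_mul_Pmx (R : realType) (N : nat) (M : 'I_N -> nat)
    (H : forall n, 'M[R]_(M n, N)) (I : 'I_N -> {set 'I_N}) (theta : 'cV[R]_N) :
  (forall n, [set j | col j (H n) != 0]%SET \subset I n) ->
  (GH H)^T *m (Pmx R I *m \mxcol_(n < N) theta) = \mxcol_(n < N) (H n *m theta).
Proof.
move=> HI; rewrite /GH tr_mxblock mxblockEv mxcol_mul; apply/eq_mxcolP => n.
rewrite /Pmx mul_mxdiag_mxcol mul_mxrow_mxcol (bigD1 n)//= eqxx trmxK.
rewrite big1 ?addr0 => [|l ln]; last by rewrite (negbTE ln) trmx0 mul0mx.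
apply/colP => k; rewrite !mxE; apply: eq_bigr => j _; rewrite proj_mulE.
have [_|jI] := boolP (j \in I n); first by rewrite mul1r.
have /eqP/colP/(_ k) : col j (H n) == 0.
  by apply: contraNT jI => Hj; apply: (fintype.subsetP (HI n)); rewrite inE.
by rewrite !mxE => ->; rewrite !mul0r.
Qed.

Lemma Pmx_idem (R : realType) (N : nat) (I : 'I_N -> {set 'I_N})
    (y : 'cV[R]_(\sum_(n < N) N)) :
  Pmx R I *m (Pmx R I *m y) = Pmx R I *m y.
Proof.
apply/mxcolP => n; apply/colP => i; rewrite !submxcol_Pmx mulrA.
by case: (i \in I n); rewrite ?mul1r ?mul0r.
Qed.

(** * The error recursion of the estimator and its rate *)

Theorem mainTheorem2
  (R : realType) (d : measure_display) (T : measurableType d)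
  (P : probability T R)
  (* sensing model *)
  (N : nat) (M : 'I_N -> nat) (H : forall n, 'M[R]_(M n, N))
  (theta : 'cV[R]_N)
  (gamma : forall n, nat -> T -> 'cV[R]_(M n))
  (Rn : forall n, 'M[R]_(M n))
  (noise_iid :
     iid P (fun t w => \mxcol_(n < N) gamma n t w))
  (noise_mean : forall n t i, ('E_P[fun w => (gamma n t w i 0)%R] = 0)%E)
  (noise_cov : forall t i j,
     covariance P (fun w => (\mxcol_(n < N) gamma n t w) i 0)
                  (fun w => (\mxcol_(n < N) gamma n t w) j 0) =
     ((\mxdiag_(n < N) Rn n) i j)%:E)
  (Rn_nonsingular : forall n, Rn n \in unitmx)
  (* communication *)
  (L : nat -> T -> 'M[R]_N)
  (L_laplacian : forall t w, is_graph_laplacian (L t w))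
  (L_iid : iid P L)
  (L_noise_indep :
     independent_processes P L (fun t w => \mxcol_(n < N) gamma n t w))
  (* interest sets *)
  (Itilde I : 'I_N -> {set 'I_N})
  (Itilde_def : forall n, Itilde n = [set j | col j (H n) != 0]%SET)
  (Itilde_neq0 : forall n, Itilde n != finset.set0)
  (I_neq0 : forall n, I n != finset.set0)
  (* weights and constants *)
  (a beta0 delta1 eps1 c1 : R)
  (a_gt0 : 0 < a) (beta0_gt0 : 0 < beta0)
  (eps1_gt0 : 0 < eps1) (c1_gt0 : 0 < c1)
  (delta1_gt0 : 0 < delta1)
  (delta1_lt : delta1 < 1 / 2 - 1 / (2 + eps1))
  (A1 : forall n t,
     ('E_P[fun w => (norm2 (gamma n t w) `^ (2 + eps1))%R] < +oo)%E)
  (A2 : \rank (\sum_(n < N) (H n)^T *m invmx (Rn n) *m H n)%R = N)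
  (A3 : forall n, Itilde n \subset I n)
  (A4 : 0 < lambda_2 (mean_mx P (L 0%N)))
  (A5 : forall y : 'cV[R]_(\sum_(n < N) N),
     (exists w, y = Pmx R I *m w) ->
     c1 * norm2 y ^+ 2 <=
     (y^T *m ((beta0 / alpha a 0) *: mean_mx P (fun w => LP I (L 0%N w)) +
              Pmx R I *m GH H *m invmx (\mxdiag_(n < N) Rn n) *m (GH H)^T
                *m Pmx R I) *m y) 0 0)
  (A6 : 1 <= a * Num.min
     (lambda_min (\sum_(n < N) proj_mx_of R (I n) *m (H n)^T
                    *m invmx (Rn n) *m H n *m proj_mx_of R (I n)))
     (Num.min c1 beta0^-1))
  (* algorithm *)
  (x : nat -> T -> 'cV[R]_(\sum_(n < N) N))
  (x0 : 'cV[R]_(\sum_(n < N) N))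
  (x0_proj : x0 = Pmx R I *m x0)
  (x_init : forall w, x 0%N w = x0)
  (x_rec : forall t w,
     x t.+1 w = x t w - beta beta0 delta1 t *: (LP I (L t w) *m x t w) +
       alpha a t *: (Pmx R I *m GH H *m invmx (\mxdiag_(n < N) Rn n) *m
         (\mxcol_(n < N) (H n *m theta + gamma n t w)
            - (GH H)^T *m Pmx R I *m x t w))) :
  let mse t :=
    ('E_P[fun w => (norm2 (x t w - Pmx R I *m \mxcol_(n < N) theta) ^+ 2)%R])%E in
  (\forall t \near \oo, mse t \is a fin_num) /\
  (fun t => fine (mse t)) =O_\oo (fun t => (t%:R : R)^-1).
Proof.
move=> mse.
set g := fun t w => \mxcol_(n < N) gamma n t w in noise_iid L_noise_indep.
set Rinv := invmx (\mxdiag_(n < N) Rn n) in A5 x_rec *.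
pose Theta : 'cV[R]_(\sum_(n < N) N) := \mxcol_(n < N) theta.
pose B := Pmx R I *m GH H *m Rinv.
pose K := B *m (GH H)^T *m Pmx R I.
pose e t w := x t w - Pmx R I *m Theta.
pose kap : R := 2 * N%:R.
have kap0 : 0 <= kap by rewrite mulr_ge0.
have F_ge0 t w (y : 'cV[R]_(\sum_(n < N) N)) :
    0 <= (y^T *m LP I (L t w) *m y) 0 0.
  by have [E [Es Ei ->]] := L_laplacian t w; exact: LP_ge0.
have F_kap t w (y : 'cV[R]_(\sum_(n < N) N)) : norm2 (LP I (L t w) *m y) ^+ 2 <=
    kap * (y^T *m LP I (L t w) *m y) 0 0.
  by have [E [Es Ei ->]] := L_laplacian t w; exact: LP_norm2_le.
have F_le t w i j : `|LP I (L t w) i j| <= kap.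
  exact: (entry_le_psd kap0 (F_ge0 t w) (F_kap t w)).
have P_LP t w (y : 'cV[R]_(\sum_(n < N) N)) :
    Pmx R I *m (LP I (L t w) *m y) = LP I (L t w) *m y.
  by have [E [Es Ei ->]] := L_laplacian t w; exact: Pmx_LP.
have LP_Theta t w : LP I (L t w) *m (Pmx R I *m Theta) = 0.
  by have [E [Es Ei ->]] := L_laplacian t w; exact: LP_consensus.
have g_mom t s : [/\ L2 P (fun w => g t w s 0),
    (\int[P]_w g t w s 0)%R = 0 &
    (\int[P]_w (g t w s 0 ^+ 2))%R = (\mxdiag_(n < N) Rn n) s s].
  apply: centered_second_moment; last exact: noise_cov.
    have [mg _ _] := noise_iid; move=> _ U mU; rewrite setTI.
    by apply: (mg t); exact: sigma_of_g.
  rewrite -(noise_mean (tagnat.sig1 s) t (tagnat.sig2 s)).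
  by congr ('E_P[_])%E; apply/funext => w; rewrite /g /mxcol mxE.
have x_proj t w : Pmx R I *m x t w = x t w.
  elim: t => [|t IH]; first by rewrite x_init -x0_proj.
  rewrite x_rec; set v := (X in alpha a t *: (_ *m X)).
  rewrite mulmxDr mulmxBr IH -!scalemxAr P_LP; congr (_ + _ *: _).
  by rewrite -!mulmxA Pmx_idem.
have e_proj t w : e t w = Pmx R I *m e t w.
  by rewrite /e mulmxBr x_proj Pmx_idem.
have e_rec t w : e t.+1 w =
    e t w - beta beta0 delta1 t *: (LP I (L t w) *m e t w) -
    alpha a t *: (K *m e t w) + alpha a t *: (B *m g t w).
  have -> : LP I (L t w) *m e t w = LP I (L t w) *m x t w.
    by rewrite /e mulmxBr LP_Theta subr0.
  (* The noiseless observation is that of the masked consensus state, so the innovation depends on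
     [x] only through the error. *)
  have obs : B *m (\mxcol_(n < N) (H n *m theta + gamma n t w) -
      (GH H)^T *m Pmx R I *m x t w) = B *m g t w - K *m e t w.
    rewrite mxcolD -(GH_tr_mul_Pmx (I := I)); last first.
      by move=> n; rewrite -Itilde_def; exact: A3.
    have -> : K *m e t w = B *m ((GH H)^T *m (Pmx R I *m e t w)).
      by rewrite /K !mulmxA.
    rewrite -/(g t w) -/Theta -(mulmxA (GH H)^T) -mulmxBr; congr (B *m _).
    rewrite /e (mulmxBr (Pmx R I)) Pmx_idem mulmxBr.
    by rewrite opprB addrCA addrA.
  rewrite {1}/e x_rec obs scalerBr {1}/e.
  move: (beta _ _ _ *: _) (alpha _ _ *: (B *m _)) (alpha _ _ *: (K *m _)).
  by move=> p k b; apply/colP => i; rewrite !mxE; ring.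
have alpha0 : alpha a 0 = a by rewrite /alpha divr1.
have alpha_ge0 t : 0 <= alpha a t by rewrite /alpha divr_ge0 ?ltW.
have e_init w : e 0%N w = x0 - Pmx R I *m Theta by rewrite /e x_init.
(* A5 applies since the error lies in the range of [Pmx]; its ratio [beta0 / alpha a 0] is
   [beta0 / a], the value of [rho]. *)
have coer t w : c1 * norm2 (e t w) ^+ 2 <=
    ((e t w)^T *m ((beta0 / a) *: mean_mx P (fun w => LP I (L 0%N w)) + K) *m
       e t w) 0 0.
  by rewrite -alpha0; apply: A5; exists (e t w).
have g_L2 t s : L2 P (fun w => g t w s 0) by case: (g_mom t s).
have g_mean t s : (\int[P]_w g t w s 0)%R = 0 by case: (g_mom t s).
have g_var t s : (\int[P]_w (g t w s 0 ^+ 2))%R = (\mxdiag_(n < N) Rn n) s s.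
  by case: (g_mom t s).
have [C1 [C2 [C20 step]]] := mean_square_step L_iid noise_iid L_noise_indep
  (@measurable_LP R N I) F_le F_ge0 F_kap g_L2 g_mean g_var alpha_ge0 e_init
  e_rec coer.
have e_L2 t i : L2 P (fun w => e t w i 0).
  exact: (L2_e L_iid noise_iid (@measurable_LP R N I) F_le g_L2 e_init e_rec).
pose m t : R := (\int[P]_w (norm2 (e t w) ^+ 2))%R.
have mseE t : mse t = (m t)%:E.
  rewrite /mse unlock /m /Rintegral fineK//.
  by apply: integrable_fin_num => //; exact: (L1_norm2 (e_L2 t)).
have delta1_lt1 : delta1 < 1.
  have : 0 < 1 / (2 + eps1) by rewrite divr_gt0//; lra.
  by move: delta1_lt; lra.
have [t0 t0P] := innovation_gain_dominated kap beta0_gt0 delta1_gt0 delta1_lt1.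
(* This makes the linear decrease [2 * c1 * alpha a t] at least [2 / (t+1)], as the recursion lemma
   requires. *)
have ac1 : 1 <= a * c1.
  by rewrite (le_trans A6)// ler_wpM2l ?(ltW a_gt0)// !ge_min lexx orbT.
have m_ge0 t : 0 <= m t by apply: Rintegral_ge0 => w _; exact: sqr_ge0.
have [||Kc [t1 mK]] := @stochastic_approx_rate R m (C1 * a ^+ 2) (C2 * a ^+ 2)
  t0 m_ge0.
- by rewrite mulr_ge0 ?sqr_ge0.
(* The gain condition involves [rho * alpha a t = beta0 / (t+1)], the quantity already dominated for
   [t >= t0]. *)
- move=> t tt0; apply: le_trans (step t _) _; rewrite -/(m t).
    apply: le_trans (t0P t tt0); rewrite /alpha.
    by rewrite mulrA divfK// gt_eqF.
  rewrite /alpha !expr_div_n !mulrA lerD2r ler_wpM2r ?m_ge0//.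
  rewrite lerD2r lerD2l lerN2 ler_pM2r ?invr_gt0 ?ltr0n//.
  by move: ac1; lra.
(* [mse t] is finite for every [t], so [fine] never returns its default value. *)
split; first by near=> t; rewrite mseE.
apply/eqO_exP; exists (`|Kc| + 1); first by rewrite ltr_wpDl.
near=> t; rewrite mseE/=.
have tt1 : (t1 <= t)%N by near: t; exists t1.
rewrite ger0_norm ?m_ge0// (le_trans (mK t tt1))//.
rewrite [X in _ <= _ * X]ger0_norm ?invr_ge0// ler_wpM2r ?invr_ge0//.
by rewrite (le_trans (ler_norm _))// lerDl.
Unshelve. all: by end_near.
Qed.
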